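(* Let $f:X\to Y$ be a smooth map of Frölicher spaces. Then $(\mathbf I_f,X)$ is an SNDR pair, where $X$ is identified with the subspace $\{[0,x]:x\in X\}$ of the flattened mapping cylinder $\mathbf I_f$ via $x\mapsto[0,x]$.
   Context: A Frölicher space is a triple $(X,\mathcal C_X,\mathcal F_X)$ with $\mathcal C_X\subseteq X^{\mathbb R}$, $\mathcal F_X\subseteq\mathbb R^X$, such that $\mathcal F_X=\{f\mid f\circ c\in C^\infty(\mathbb R,\mathbb R)\ \forall c\in\mathcal C_X\}$ and $\mathcal C_X=\{c\mid f\circ c\in C^\infty(\mathbb R,\mathbb R)\ \forall f\in\mathcal F_X\}$. A map $\varphi:X\to Y$ is smooth if $g\circ\varphi\in\mathcal F_X$ for all $g\in\mathcal F_Y$. Subspaces carry the initial structure; products the structure generated by $f\circ\pi_i$; coproducts, quotients and pushouts carry the final structure. $I$ is $[0,1]$ with the subspace structure from $\mathbb R$ ($\mathcal F_I$ its structure functions). $\mathbf I$ is $[0,1]$ with the structure generated by those $f\in\mathcal F_I$ for which some $0<\epsilon<1/4$ has $f$ constant on $[0,\epsilon)$ and on $(1-\epsilon,1]$. The flattened mapping cylinder $\mathbf I_f$ is the pushout of $f:X\to Y$ and $i_1:X\to\mathbf I\times X$, $i_1(x)=(1,x)$, i.e. the quotient of $(\mathbf I\times X)\sqcup Y$ by $(1,x)\sim f(x)$; its elements are written $[t,x]$ and $[y]$. FCIP: Let $i:A\to X$ be smooth. For a structure curve $x:\mathbb R\to X$ let $\Lambda(x,i)$ be the set of $s_*\in x^{-1}(i(A))$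 that are limits of sequences $s_n\in x^{-1}(X\setminus i(A))$. A structure function $g$ on $\mathbf I\times X$ has the FCIP w.r.t. $i$ if $g\circ c$ is $C^\infty$ for every map $c=(t,x):\mathbb R\to[0,1]\times X$ with $x$ a structure curve of $X$ and, for every $\epsilon>0$, $t$ $C^\infty$ on every open interval disjoint from $\bigcup_{s_*\in\Lambda(x,i)}[s_*-\epsilon,s_*+\epsilon]$. A map $g:\mathbf I\times X\to Z$ has the FCIP if $h\circ g$ does for every $h\in\mathcal F_Z$. SNDR pair: for a smooth inclusion $i:A\hookrightarrow X$, $(X,A)$ is an SNDR pair if there are a smooth $u:X\to\mathbf I$ with $u^{-1}(0)=i(A)$ and a smooth $H:\mathbf I\times X\to X$ having the FCIP w.r.t. $i$, with $H(0,x)=x$ for all $x$, $H(t,a)=a$ for all $t$ and $a\in i(A)$, and $H(1,x)\in i(A)$ whenever $u(x)<1$. *)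

(* Defs.v *)
From Stdlib Require Import Reals Lra Relations.
Open Scope R_scope.

(** C^infinity on an open set U (used with U = R or an open interval):
    a sequence of successive derivatives exists on U. *)
Definition smooth_on (U : R -> Prop) (f : R -> R) : Prop :=
  exists D : nat -> R -> R,
    (forall s, U s -> D O s = f s) /\
    (forall n s, U s -> derivable_pt_lim (D n) s (D (S n) s)).

Definition smooth (f : R -> R) : Prop := smooth_on (fun _ => True) f.

Record Frolicher := {
  carrier :> Type;
  curves : (R -> carrier) -> Prop;
  funcs : (carrier -> R) -> Prop;
  funcs_spec : forall f, funcs f <-> (forall c, curves c -> smooth (fun s => f (c s)));
  curves_spec : forall c, curves c <-> (forall f, funcs f -> smooth (fun s => f (c s)))
}.

Definition gen_funs (T : Type) (F0 : (T -> R) -> Prop) : Frolicher.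
Proof.
  refine {| carrier := T;
            curves := fun c => forall f, F0 f -> smooth (fun s => f (c s));
            funcs := fun f => forall c, (forall g, F0 g -> smooth (fun s => g (c s))) ->
                                        smooth (fun s => f (c s)) |}.
  - intros f; tauto.
  - intros c; split.
    + intros Hc f Hf; exact (Hf c Hc).
    + intros H f Hf; apply H; intros c' Hc'; exact (Hc' f Hf).
Defined.

Definition gen_curves (T : Type) (C0 : (R -> T) -> Prop) : Frolicher.
Proof.
  refine {| carrier := T;
            curves := fun c => forall f, (forall d, C0 d -> smooth (fun s => f (d s))) ->
                                         smooth (fun s => f (c s));
            funcs := fun f => forall c, C0 c -> smooth (fun s => f (c s)) |}.
  - intros f; split.
    + intros Hf c Hc; exact (Hc f Hf).
    + intros H c Hc; apply H; intros f' Hf'; exact (Hf' c Hc).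
  - intros c; tauto.
Defined.

Definition smooth_map (X Y : Frolicher) (phi : X -> Y) : Prop :=
  forall g, funcs Y g -> funcs X (fun x => g (phi x)).

Definition Rfr : Frolicher := gen_funs R smooth.

Definition subspace (X : Frolicher) (P : X -> Prop) : Frolicher :=
  gen_funs {x : X | P x}
    (fun g => exists f, funcs X f /\ g = (fun a => f (proj1_sig a))).

Definition prodF (X Y : Frolicher) : Frolicher :=
  gen_funs (X * Y)%type
    (fun g => (exists f, funcs X f /\ g = (fun p => f (fst p))) \/
              (exists f, funcs Y f /\ g = (fun p => f (snd p)))).

Definition coprodF (X Y : Frolicher) : Frolicher :=
  gen_curves (X + Y)%type
    (fun c => (exists d, curves X d /\ c = (fun s => inl (d s))) \/
              (exists d, curves Y d /\ c = (fun s => inr (d s)))).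

Definition Quot (T : Type) (E : T -> T -> Prop) : Type :=
  {P : T -> Prop | exists z, P = clos_refl_sym_trans T E z}.

Definition qclass {T : Type} (E : T -> T -> Prop) (z : T) : Quot T E :=
  exist _ (clos_refl_sym_trans T E z) (ex_intro _ z eq_refl).

Definition quotF (X : Frolicher) (E : X -> X -> Prop) : Frolicher :=
  gen_curves (Quot X E)
    (fun c => exists d, curves X d /\ c = (fun s => qclass E (d s))).

Definition I01 : Type := {t : R | 0 <= t <= 1}.
Definition Izero : I01 := exist _ 0 (conj (Rle_refl 0) Rle_0_1).
Definition Ione : I01 := exist _ 1 (conj Rle_0_1 (Rle_refl 1)).

Definition Ifr : Frolicher := subspace Rfr (fun t => 0 <= t <= 1).

Definition Ibold : Frolicher :=
  gen_funs I01
    (fun f => funcs Ifr f /\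
       exists eps, 0 < eps < 1/4 /\
         (forall a b : I01, proj1_sig a < eps -> proj1_sig b < eps -> f a = f b) /\
         (forall a b : I01, 1 - eps < proj1_sig a -> 1 - eps < proj1_sig b -> f a = f b)).

Definition cyl_rel (X Y : Frolicher) (f : X -> Y) : (I01 * X + Y)%type -> (I01 * X + Y)%type -> Prop :=
  fun a b => exists x, a = inl (Ione, x) /\ b = inr (f x).

Definition Icyl (X Y : Frolicher) (f : X -> Y) : Frolicher :=
  quotF (coprodF (prodF Ibold X) Y) (cyl_rel X Y f).

Definition cyl_incl (X Y : Frolicher) (f : X -> Y) (x : X) : Icyl X Y f :=
  qclass (cyl_rel X Y f) (inl (Izero, x)).

Definition Lambda {A Z : Frolicher} (i : A -> Z) (x : R -> Z) (s0 : R) : Prop :=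
  (exists a, x s0 = i a) /\
  exists sn : nat -> R, (forall n, ~ (exists a, x (sn n) = i a)) /\ Un_cv sn s0.

Definition FCIP_fun {A Z : Frolicher} (i : A -> Z) (g : (I01 * Z)%type -> R) : Prop :=
  forall (t : R -> I01) (x : R -> Z),
    curves Z x ->
    (forall eps, 0 < eps -> forall a b : R,
        (forall s, a < s < b -> forall s0, Lambda i x s0 -> ~ (s0 - eps <= s <= s0 + eps)) ->
        smooth_on (fun s => a < s < b) (fun s => proj1_sig (t s))) ->
    smooth (fun s => g (t s, x s)).

Definition FCIP_map {A Z W : Frolicher} (i : A -> Z) (H : (I01 * Z)%type -> W) : Prop :=
  forall h, funcs W h -> FCIP_fun i (fun p => h (H p)).

Definition SNDR_pair (X A : Frolicher) (i : A -> X) : Prop :=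
  smooth_map A X i /\ (forall a b, i a = i b -> a = b) /\
  exists (u : X -> I01) (H : (I01 * X)%type -> X),
    smooth_map X Ibold u /\
    (forall x, proj1_sig (u x) = 0 <-> exists a, x = i a) /\
    smooth_map (prodF Ibold X) X H /\
    FCIP_map i H /\
    (forall x, H (Izero, x) = x) /\
    (forall (t : I01) a, H (t, i a) = i a) /\
    (forall x, proj1_sig (u x) < 1 -> exists a, H (Ione, x) = i a).

(* Main.v *)
(** Every structure function of the flattened interval is locally constant at
    the end points along structure curves, so a curve [t] of [Ibold] is just a
    continuous map to [[0,1]] that is smooth where [0 < t < 1].  Let [tau] be
    the height function [[t,x] |-> t], [[y] |-> 1] on the mapping cylinder, and
    put [u := min (1, 2 tau)] and [H (s, [t,x]) := [t (1 - alpha s * beta t), x]],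
    where [alpha] is flat at both ends and [beta] is [1] on [[0,1/2]] and [0] on
    [[3/4,1]]; [H] fixes the [Y] part.  Along a curve of the cylinder, [H] is
    locally the identity where [tau > 3/4].  Where [tau < 7/8] the curve lifts
    locally to [(t,x)], and the height of [H] is at most [t]: it is therefore
    continuous at the zeros of [t] however badly the time parameter behaves
    there, which is what FCIP asks for. *)

Require Import Defs.
From Stdlib Require Import Reals Lra Lia Relations Factorial.
From Stdlib Require Import FunctionalExtensionality PropExtensionality.
From Stdlib Require Import ProofIrrelevance IndefiniteDescription.
From Corelib Require Import ssreflect.
From Coquelicot Require Import Coquelicot.
Open Scope R_scope.

(** * Smooth germs *)

Lemma locally_imp {s : R} {P Q : R -> Prop} :
  locally s P -> (forall y, P y -> Q y) -> locally s Q.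
Proof. intros HP HPQ; exact (filter_imp _ _ HPQ HP). Qed.

(** [Derive] is total, so differentiability is demanded on a whole neighbourhood at each order; this
    gives [Derive f] its meaning near [s] before the recursion descends to it. *)
Fixpoint diff_germ (n : nat) (f : R -> R) (s : R) : Prop :=
  match n with
  | O => True
  | S m => locally s (fun y => ex_derive f y) /\ diff_germ m (Derive f) s
  end.

(* The neighbourhood of [s] may depend on the order of differentiation. *)
Definition smooth_at (f : R -> R) (s : R) : Prop := forall n, diff_germ n f s.

Lemma diff_germ_ext_loc n f g s :
  locally s (fun y => f y = g y) -> diff_germ n f s -> diff_germ n g s.
Proof.
  revert f g; induction n as [|n IH]; intros f g E Hf; [exact I|].
  destruct Hf as [Hd Hf]; pose proof (locally_locally _ _ E) as E2; split.
  - apply (locally_imp (filter_and _ _ Hd E2)).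
    intros y [Hy Ey]; exact (ex_derive_ext_loc f g y Ey Hy).
  - apply (IH (Derive f)); [|exact Hf].
    apply (locally_imp E2); intros y Ey; now apply Derive_ext_loc.
Qed.

(** The product and chain rules at order [S n] contain undifferentiated factors, to which the
    induction hypothesis applies only at order [n]. *)
Lemma diff_germ_pred n f s : diff_germ (S n) f s -> diff_germ n f s.
Proof.
  revert f; induction n as [|n IH]; intros f [H1 H2]; [exact I|].
  split; [exact H1|now apply IH].
Qed.

Lemma diff_germ_const n c s : diff_germ n (fun _ => c) s.
Proof.
  revert c; induction n as [|n IH]; intros c; [exact I|]; split.
  - apply filter_forall; intros y; apply ex_derive_const.
  - apply (diff_germ_ext_loc n (fun _ => 0)); [|apply IH].
    apply filter_forall; intros y; now rewrite Derive_const.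
Qed.

Lemma diff_germ_plus n f g s :
  diff_germ n f s -> diff_germ n g s -> diff_germ n (fun y => f y + g y) s.
Proof.
  revert f g; induction n as [|n IH]; intros f g Hf Hg; [exact I|].
  destruct Hf as [Hf1 Hf2], Hg as [Hg1 Hg2].
  pose proof (filter_and _ _ Hf1 Hg1) as H; split.
  - apply (locally_imp H); intros y [Hy1 Hy2].
    exact (ex_derive_plus f g y Hy1 Hy2).
  - apply (diff_germ_ext_loc n (fun y => Derive f y + Derive g y)); [|now apply IH].
    apply (locally_imp H); intros y [Hy1 Hy2]; now rewrite Derive_plus.
Qed.

Lemma diff_germ_mult n f g s :
  diff_germ n f s -> diff_germ n g s -> diff_germ n (fun y => f y * g y) s.
Proof.
  revert f g; induction n as [|n IH]; intros f g Hf Hg; [exact I|].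
  pose proof (diff_germ_pred _ _ _ Hf) as Hf0.
  pose proof (diff_germ_pred _ _ _ Hg) as Hg0.
  destruct Hf as [Hf1 Hf2], Hg as [Hg1 Hg2].
  pose proof (filter_and _ _ Hf1 Hg1) as H; split.
  - apply (locally_imp H); intros y [Hy1 Hy2].
    exact (ex_derive_mult f g y Hy1 Hy2).
  - apply (diff_germ_ext_loc n (fun y => Derive f y * g y + f y * Derive g y)).
    + apply (locally_imp H); intros y [Hy1 Hy2]; now rewrite Derive_mult.
    + apply diff_germ_plus; now apply IH.
Qed.

Lemma diff_germ_comp n f g s :
  diff_germ n f (g s) -> diff_germ n g s -> diff_germ n (fun y => f (g y)) s.
Proof.
  revert f g; induction n as [|n IH]; intros f g Hf Hg; [exact I|].
  pose proof (diff_germ_pred _ _ _ Hg) as Hg0.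
  destruct Hf as [Hf1 Hf2], Hg as [Hg1 Hg2].
  assert (H : locally s (fun y => ex_derive f (g y) /\ ex_derive g y)).
  { apply filter_and; [|exact Hg1].
    (* Continuity of [g] pulls the neighbourhood of [g s] on which [f] is differentiable back to one
       of [s]. *)
    apply (ex_derive_continuous g s (locally_singleton _ _ Hg1)); exact Hf1. }
  split.
  - apply (locally_imp H); intros y [Hy1 Hy2].
    exact (ex_derive_comp f g y Hy1 Hy2).
  - apply (diff_germ_ext_loc n (fun y => Derive g y * Derive f (g y))).
    + apply (locally_imp H); intros y [Hy1 Hy2]; symmetry; exact (Derive_comp f g y Hy1 Hy2).
    + apply diff_germ_mult; [exact Hg2|now apply IH].
Qed.

Lemma smooth_at_ext_loc f g s :
  locally s (fun y => f y = g y) -> smooth_at f s -> smooth_at g s.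
Proof. intros E H n; exact (diff_germ_ext_loc n f g s E (H n)). Qed.

Lemma smooth_at_const c s : smooth_at (fun _ => c) s.
Proof. intros n; apply diff_germ_const. Qed.

Lemma smooth_at_id s : smooth_at (fun y => y) s.
Proof.
  intros [|n]; [exact I|]; split.
  - apply filter_forall; intros y; apply ex_derive_id.
  - apply (diff_germ_ext_loc n (fun _ => 1)); [|apply diff_germ_const].
    apply filter_forall; intros y; now rewrite Derive_id.
Qed.

Lemma smooth_at_plus f g s :
  smooth_at f s -> smooth_at g s -> smooth_at (fun y => f y + g y) s.
Proof. intros Hf Hg n; now apply diff_germ_plus. Qed.

Lemma smooth_at_mult f g s :
  smooth_at f s -> smooth_at g s -> smooth_at (fun y => f y * g y) s.
Proof. intros Hf Hg n; now apply diff_germ_mult. Qed.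

Lemma smooth_at_comp f g s :
  smooth_at f (g s) -> smooth_at g s -> smooth_at (fun y => f (g y)) s.
Proof. intros Hf Hg n; now apply diff_germ_comp. Qed.

Lemma smooth_at_opp f s : smooth_at f s -> smooth_at (fun y => - f y) s.
Proof.
  intros H; apply (smooth_at_ext_loc (fun y => -1 * f y)).
  - apply filter_forall; intros y; ring.
  - apply smooth_at_mult; [apply smooth_at_const|exact H].
Qed.

Lemma smooth_at_minus f g s :
  smooth_at f s -> smooth_at g s -> smooth_at (fun y => f y - g y) s.
Proof. intros Hf Hg; apply smooth_at_plus; [exact Hf|now apply smooth_at_opp]. Qed.

Lemma smooth_at_Rinv s : s <> 0 -> smooth_at Rinv s.
Proof.
  intros Hs n.
  assert (Hnz : forall t, t <> 0 -> locally t (fun y => y <> 0)).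
  { intros t Ht; now apply (open_neq 0). }
  revert s Hs; induction n as [|n IH]; intros s Hs; [exact I|]; split.
  - apply (locally_imp (Hnz s Hs)); intros y Hy; auto_derive; exact Hy.
  - apply (diff_germ_ext_loc n (fun y => -1 * (/ y * / y))).
    + apply (locally_imp (Hnz s Hs)); intros y Hy; symmetry.
      apply is_derive_unique; auto_derive; [exact Hy|field; exact Hy].
    + apply diff_germ_mult; [apply diff_germ_const|].
      apply diff_germ_mult; now apply IH.
Qed.

Lemma smooth_at_continuous f s : smooth_at f s -> continuous f s.
Proof.
  intros H; destruct (H 1%nat) as [H1 _].
  exact (ex_derive_continuous f s (locally_singleton _ _ H1)).
Qed.

Lemma smooth_on_smooth_at (U : R -> Prop) f s :
  open U -> U s -> smooth_on U f -> smooth_at f s.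
Proof.
  intros HU Us (D & D0 & DS).
  assert (G : forall n k, diff_germ n (D k) s).
  { induction n as [|n IH]; intros k; [exact I|]; split.
    - apply (locally_imp (HU s Us)); intros y Uy.
      exists (D (S k) y); apply is_derive_Reals, (DS k y Uy).
    - apply (diff_germ_ext_loc n (D (S k))); [|apply IH].
      apply (locally_imp (HU s Us)); intros y Uy; symmetry.
      apply is_derive_unique, is_derive_Reals, (DS k y Uy). }
  apply (smooth_at_ext_loc (D O)); [|intros n; apply G].
  apply (locally_imp (HU s Us)); intros y Uy; exact (D0 y Uy).
Qed.

Lemma smooth_smooth_at f : smooth f <-> forall s, smooth_at f s.
Proof.
  split.
  - intros H s; apply (smooth_on_smooth_at (fun _ => True)); [apply open_true|exact I|exact H].
  (* Neighbourhoods that shrink with the order do no harm: [Derive_n f] is defined everywhere, and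
     each order only has to be differentiable at each point. *)
  - intros H; exists (Derive_n f); split; [reflexivity|].
    assert (G : forall n s, smooth_at (Derive_n f n) s).
    { induction n as [|n IH]; [exact H|].
      intros s m; exact (proj2 (IH s (S m))). }
    intros n s _; apply is_derive_Reals, Derive_correct.
    exact (locally_singleton _ _ (proj1 (G n s 1%nat))).
Qed.

(** * Cut-off functions *)

(* [x^-k exp (-1/x)], extended by zero: this family is stable under
   differentiation up to linear combinations. *)
Definition flat_exp (k : nat) (x : R) : R :=
  match Rle_dec x 0 with left _ => 0 | right _ => (/ x) ^ k * exp (- / x) end.

(** Induction on [k] with the mean value theorem: [y ^ (k+1) - (k+1)! exp y] is negative at 0 and,
    by the bound for [k], has nonpositive derivative for [y >= 0]. *)
Lemma pow_le_fact_exp k y : 0 <= y -> y ^ k <= INR (fact k) * exp y.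
Proof.
  revert y; induction k as [|k IH]; intros y Hy.
  - simpl; pose proof (exp_ineq1_le y); lra.
  - rewrite fact_simpl mult_INR.
    destruct (MVT_gen (fun t => t ^ S k - INR (S k) * INR (fact k) * exp t) 0 y
      (fun t => INR (S k) * (t ^ k - INR (fact k) * exp t))) as (c & Hc & E).
    + intros x _; auto_derive; [exact I|].
      change (INR (S k)) with (match k with O => 1 | S _ => INR k + 1 end); ring.
    + intros x _; apply derivable_continuous_pt, ex_derive_Reals_0.
      auto_derive; exact I.
    + rewrite Rmin_left in Hc; [|exact Hy]. rewrite Rmax_right in Hc; [|exact Hy].
      pose proof (IH c (proj1 Hc)) as Hk.
      pose proof (pos_INR (S k)); pose proof (pos_INR (fact k)).
      pose proof (Rmult_le_pos _ _ (pos_INR (S k)) (pos_INR (fact k))).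
      rewrite exp_0 in E; rewrite (pow_i (S k)) in E; [|lia].
      assert (INR (S k) * (c ^ k - INR (fact k) * exp c) * (y - 0) <= 0); [|lra].
      assert (0 <= INR (S k) * (INR (fact k) * exp c - c ^ k) * (y - 0)); [|lra].
      apply Rmult_le_pos; [apply Rmult_le_pos|]; lra.
Qed.

(** For positive [x] this is the exponential bound at [/ x] with exponent [k + 2]. The spare factor
    [x ^ 2] makes the derivative at 0 exist and vanish. *)
Lemma flat_exp_bound k x : 0 <= flat_exp k x <= INR (fact (k + 2)) * x ^ 2.
Proof.
  pose proof (pos_INR (fact (k + 2))); pose proof (pow2_ge_0 x).
  unfold flat_exp; destruct (Rle_dec x 0) as [Hx|Hx].
  - split; [lra|now apply Rmult_le_pos].
  - assert (Hi : 0 < / x) by (apply Rinv_0_lt_compat; lra).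
    pose proof (exp_pos (- / x)); split.
    + apply Rmult_le_pos; [apply pow_le|]; lra.
    + pose proof (pow_le_fact_exp (k + 2) (/ x) (Rlt_le _ _ Hi)) as P.
      apply (Rmult_le_compat_r (x ^ 2 * exp (- / x))) in P;
        [|apply Rmult_le_pos; lra].
      rewrite pow_add in P.
      replace (INR (fact (k + 2)) * exp (/ x) * (x ^ 2 * exp (- / x)))
        with (INR (fact (k + 2)) * x ^ 2 * (exp (/ x) * exp (- / x))) in P by ring.
      rewrite -exp_plus Rplus_opp_r exp_0 Rmult_1_r in P.
      replace ((/ x) ^ k * (/ x) ^ 2 * (x ^ 2 * exp (- / x)))
        with ((/ x) ^ k * exp (- / x)) in P by (field; lra).
      exact P.
Qed.

Lemma is_derive_flat_exp k x :
  is_derive (flat_exp k) x (flat_exp (k + 2) x - INR k * flat_exp (k + 1) x).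
Proof.
  destruct (Rtotal_order x 0) as [Hx|[Hx|Hx]].
  - apply (is_derive_ext_loc (fun _ => 0)).
    + apply (locally_imp (open_lt 0 x Hx)); intros y Hy.
      unfold flat_exp; destruct (Rle_dec y 0); [reflexivity|lra].
    + unfold flat_exp; destruct (Rle_dec x 0) as [_|]; [|lra].
      replace (0 - INR k * 0) with 0 by ring; apply (is_derive_const 0 x).
  - subst x; unfold flat_exp at 2 3; destruct (Rle_dec 0 0) as [_|]; [|lra].
    replace (0 - INR k * 0) with 0 by ring.
    apply is_derive_Reals; intros eps Heps.
    (* The quadratic bound keeps the difference quotient below [(k + 2)!] times [|h|]; the added 1
       makes the estimate strict. *)
    set (C := INR (fact (k + 2)) + 1).
    assert (HC : 0 < C) by (unfold C; pose proof (pos_INR (fact (k + 2))); lra).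
    assert (Hd : 0 < eps / C) by (now apply Rdiv_lt_0_compat).
    exists (mkposreal _ Hd); simpl; intros h Hh Hlt.
    rewrite Rplus_0_l.
    replace (flat_exp k 0) with 0
      by (unfold flat_exp; destruct (Rle_dec 0 0); [reflexivity|lra]).
    rewrite !Rminus_0_r.
    pose proof (flat_exp_bound k h) as B.
    pose proof (Rabs_pos_lt h Hh) as Ha.
    unfold Rdiv; rewrite Rabs_mult Rabs_inv (Rabs_pos_eq (flat_exp k h)); [|lra].
    apply (Rmult_lt_reg_r (Rabs h)); [exact Ha|].
    rewrite Rmult_assoc Rinv_l; [|lra]. rewrite Rmult_1_r.
    assert (Rabs h * C < eps).
    { apply (Rmult_lt_compat_r C) in Hlt; [|exact HC].
      unfold Rdiv in Hlt; rewrite Rmult_assoc Rinv_l in Hlt; lra. }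
    rewrite -(pow2_abs h) in B; unfold C in *; nra.
  - apply (is_derive_ext_loc (fun y => (/ y) ^ k * exp (- / y))).
    + apply (locally_imp (open_gt 0 x Hx)); intros y Hy.
      unfold flat_exp; destruct (Rle_dec y 0); [lra|reflexivity].
    + unfold flat_exp; destruct (Rle_dec x 0) as [|_]; [lra|].
      auto_derive; [split; [lra|split; [lra|exact I]]|].
      rewrite !pow_add; destruct k as [|k]; simpl; field; lra.
Qed.

Lemma smooth_at_flat_exp k s : smooth_at (flat_exp k) s.
Proof.
  intros n; revert k; induction n as [|n IH]; intros k; [exact I|]; split.
  - apply filter_forall; intros y; eexists; apply is_derive_flat_exp.
  - apply (diff_germ_ext_loc n
      (fun y => flat_exp (k + 2) y + - INR k * flat_exp (k + 1) y)).
    + apply filter_forall; intros y; symmetry.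
      rewrite (is_derive_unique _ _ _ (is_derive_flat_exp k y)); ring.
    + apply diff_germ_plus; [apply IH|].
      apply diff_germ_mult; [apply diff_germ_const|apply IH].
Qed.

Lemma flat_exp_pos x : 0 < x -> 0 < flat_exp 0 x.
Proof.
  intros Hx; unfold flat_exp; destruct (Rle_dec x 0); [lra|].
  simpl; rewrite Rmult_1_l; apply exp_pos.
Qed.

Lemma flat_exp_npos x : x <= 0 -> flat_exp 0 x = 0.
Proof. intros Hx; unfold flat_exp; destruct (Rle_dec x 0); [reflexivity|lra]. Qed.

Lemma flat_exp_denom_pos x y : 0 < x + y -> 0 < flat_exp 0 x + flat_exp 0 y.
Proof.
  intros H; pose proof (flat_exp_bound 0 x); pose proof (flat_exp_bound 0 y).
  destruct (Rle_dec x 0).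
  - pose proof (flat_exp_pos y); lra.
  - pose proof (flat_exp_pos x); lra.
Qed.

(** For [a < b], a smooth transition from 0 on [x <= a] to 1 on [x >= b]; at every [x] at least one
    of the two terms of the denominator is positive. *)
Definition smooth_step (a b x : R) : R :=
  flat_exp 0 (x - a) / (flat_exp 0 (x - a) + flat_exp 0 (b - x)).

Lemma smooth_at_step a b s : a < b -> smooth_at (smooth_step a b) s.
Proof.
  intros Hab.
  assert (H1 : smooth_at (fun x => flat_exp 0 (x - a)) s).
  { apply (smooth_at_comp (flat_exp 0)); [apply smooth_at_flat_exp|].
    apply smooth_at_minus; [apply smooth_at_id|apply smooth_at_const]. }
  apply smooth_at_mult; [exact H1|].
  apply (smooth_at_comp Rinv).
  - pose proof (flat_exp_denom_pos (s - a) (b - s)); apply smooth_at_Rinv; lra.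
  - apply smooth_at_plus; [exact H1|].
    apply (smooth_at_comp (flat_exp 0)); [apply smooth_at_flat_exp|].
    apply smooth_at_minus; [apply smooth_at_const|apply smooth_at_id].
Qed.

Lemma smooth_step_range a b x : a < b -> 0 <= smooth_step a b x <= 1.
Proof.
  intros Hab; unfold smooth_step.
  pose proof (flat_exp_denom_pos (x - a) (b - x)) as Hd.
  pose proof (flat_exp_bound 0 (x - a)); pose proof (flat_exp_bound 0 (b - x)).
  split.
  - apply Rdiv_le_0_compat; lra.
  - apply Rle_div_l; lra.
Qed.

Lemma smooth_step_0 a b x : x <= a -> smooth_step a b x = 0.
Proof.
  intros Hx; unfold smooth_step; rewrite flat_exp_npos; [|lra].
  unfold Rdiv; ring.
Qed.

Lemma smooth_step_1 a b x : a < b -> b <= x -> smooth_step a b x = 1.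
Proof.
  intros Hab Hx; unfold smooth_step.
  pose proof (flat_exp_pos (x - a)).
  rewrite (flat_exp_npos (b - x)); [|lra].
  field; lra.
Qed.

(* Precomposing with [theta] turns a property that holds near [s0] into a global
   one without changing germs at [s0]; the axioms of a Frolicher space only
   speak of curves defined on all of [R]. *)
Lemma localizing_map (s0 : R) (P : R -> Prop) :
  locally s0 P ->
  exists theta : R -> R, (forall s, smooth_at theta s) /\
    (forall s, P (theta s)) /\ locally s0 (fun s => theta s = s).
Proof.
  intros [d Hd]; pose proof (cond_pos d) as Hp.
  (* Squared radii, so that the step is applied to the smooth [(s - s0) ^ 2] and not to an absolute
     value: [chi] is 1 within [d / 3] of [s0] and 0 from distance [2 * d / 3] on. *)
  set (a := (d / 3) ^ 2); set (b := (2 * d / 3) ^ 2).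
  assert (Hab : a < b) by (unfold a, b; nra).
  set (chi := fun s => 1 - smooth_step a b ((s - s0) ^ 2)).
  exists (fun s => s0 + (s - s0) * chi s); split; [|split].
  - intros s.
    assert (Hid : smooth_at (fun y => y - s0) s)
      by (apply smooth_at_minus; [apply smooth_at_id|apply smooth_at_const]).
    apply smooth_at_plus; [apply smooth_at_const|].
    apply smooth_at_mult; [exact Hid|].
    apply smooth_at_minus; [apply smooth_at_const|].
    apply (smooth_at_comp (smooth_step a b)); [now apply smooth_at_step|].
    simpl; apply smooth_at_mult; [exact Hid|].
    apply smooth_at_mult; [exact Hid|apply smooth_at_const].
  - intros s; apply Hd; change (Rabs (s0 + (s - s0) * chi s - s0) < d).
    replace (s0 + (s - s0) * chi s - s0) with ((s - s0) * chi s) by ring.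
    pose proof (smooth_step_range a b ((s - s0) ^ 2) Hab) as Hr.
    destruct (Rle_dec b ((s - s0) ^ 2)) as [Hs|Hs].
    + unfold chi; rewrite smooth_step_1; [|exact Hab|exact Hs].
      rewrite Rminus_diag Rmult_0_r Rabs_R0; exact Hp.
    + assert (Rabs (s - s0) < 2 * d / 3).
      { apply Rnot_le_lt; intros Hle; apply Hs; unfold b.
        rewrite -(pow2_abs (s - s0)); nra. }
      rewrite Rabs_mult (Rabs_pos_eq (chi s)); [|unfold chi; lra].
      pose proof (Rabs_pos (s - s0)); unfold chi; nra.
  - assert (Hd3 : 0 < d / 3) by lra.
    exists (mkposreal _ Hd3); intros s Hs; change (Rabs (s - s0) < d / 3) in Hs.
    unfold chi; rewrite smooth_step_0; [ring|].
    unfold a; rewrite -(pow2_abs (s - s0)); pose proof (Rabs_pos (s - s0)); nra.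
Qed.

(** * Curves of the flattened interval *)

Lemma I01_eq (a b : I01) : proj1_sig a = proj1_sig b -> a = b.
Proof.
  destruct a as [a Ha], b as [b Hb]; simpl; intros E; subst b.
  f_equal; apply proof_irrelevance.
Qed.

(** A smooth [g] that is constant near both ends restricts to one of the generating functions of
    [Ibold]. *)
Lemma curves_Ibold_comp (g : R -> R) (t : R -> I01) (e : R) :
  (forall s, smooth_at g s) -> 0 < e < 1/4 ->
  (forall a b, a < e -> b < e -> g a = g b) ->
  (forall a b, 1 - e < a -> 1 - e < b -> g a = g b) ->
  curves Ibold t -> forall s, smooth_at (fun y => g (proj1_sig (t y))) s.
Proof.
  intros Hg He H0 H1 Ht; apply smooth_smooth_at.
  apply (Ht (fun a => g (proj1_sig a))); split.
  - intros c Hc; apply (Hc (fun a => g (proj1_sig a))).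
    exists g; split; [|reflexivity].
    intros d Hd; apply Hd, smooth_smooth_at, Hg.
  - exists e; split; [exact He|]; split; intros a b; auto.
Qed.

(** For small [d], a smoothed identity: 0 up to [d], exact on [[2d, 1 - 2d]], 1 from [1 - d] on.
    Being flat at the ends, it may be composed with curves of [Ibold]. *)
Definition flat_id (d x : R) : R :=
  smooth_step d (2 * d) x * x * (1 - smooth_step (1 - 2 * d) (1 - d) x)
  + smooth_step (1 - 2 * d) (1 - d) x.

Lemma smooth_at_flat_id d s : 0 < d -> smooth_at (flat_id d) s.
Proof.
  intros Hd.
  assert (HB : smooth_at (smooth_step (1 - 2 * d) (1 - d)) s)
    by (apply smooth_at_step; lra).
  apply smooth_at_plus; [|exact HB].
  apply smooth_at_mult.
  - apply smooth_at_mult; [apply smooth_at_step; lra|apply smooth_at_id].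
  - apply smooth_at_minus; [apply smooth_at_const|exact HB].
Qed.

Lemma flat_id_mid d x : 0 < d -> 2 * d <= x <= 1 - 2 * d -> flat_id d x = x.
Proof.
  intros Hd Hx; unfold flat_id.
  rewrite smooth_step_1; [|lra|lra]. rewrite smooth_step_0; [ring|lra].
Qed.

Lemma flat_id_near d x :
  0 < d <= 1/8 -> 0 <= x <= 1 -> Rabs (flat_id d x - x) <= 4 * d.
Proof.
  intros Hd Hx; unfold flat_id; apply Rabs_le.
  pose proof (smooth_step_range d (2 * d) x ltac:(lra)) as HA.
  pose proof (smooth_step_range (1 - 2 * d) (1 - d) x ltac:(lra)) as HB.
  destruct (Rle_dec x (2 * d)) as [H|H].
  - rewrite (smooth_step_0 (1 - 2 * d)); [|lra]. nra.
  - rewrite (smooth_step_1 d); [|lra|lra].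
    destruct (Rle_dec x (1 - 2 * d)) as [H'|H'].
    + rewrite smooth_step_0; lra.
    + nra.
Qed.

Lemma curves_Ibold_flat_id t d s :
  curves Ibold t -> 0 < d <= 1/8 -> smooth_at (fun y => flat_id d (proj1_sig (t y))) s.
Proof.
  intros Ht Hd; revert s; apply (curves_Ibold_comp (flat_id d) t d).
  - intros s; apply smooth_at_flat_id; lra.
  - lra.
  - intros a b Ha Hb; unfold flat_id.
    rewrite (smooth_step_0 d _ a); [|lra]. rewrite (smooth_step_0 d _ b); [|lra].
    rewrite !smooth_step_0; lra.
  - intros a b Ha Hb; unfold flat_id.
    rewrite (smooth_step_1 (1 - 2 * d) (1 - d) a); [|lra|lra].
    rewrite (smooth_step_1 (1 - 2 * d) (1 - d) b); lra.
  - exact Ht.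
Qed.

Lemma locally_Rabs (f : R -> R) s eps :
  continuous f s -> 0 < eps -> locally s (fun y => Rabs (f y - f s) < eps).
Proof.
  intros Hf He; apply (Hf (fun z => Rabs (z - f s) < eps)).
  exists (mkposreal _ He); intros z Hz; exact Hz.
Qed.

Lemma continuous_Rabs (f : R -> R) s :
  (forall eps, 0 < eps -> locally s (fun y => Rabs (f y - f s) < eps)) ->
  continuous f s.
Proof.
  intros H P [eps HP]; apply (locally_imp (H eps (cond_pos eps))).
  intros y Hy; apply HP; exact Hy.
Qed.

Lemma locally_lt (f : R -> R) s c :
  continuous f s -> f s < c -> locally s (fun y => f y < c).
Proof.
  intros Hf Hc; apply (locally_imp (locally_Rabs f s (c - f s) Hf ltac:(lra))).
  intros y Hy; apply Rabs_lt_between in Hy; lra.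
Qed.

Lemma locally_gt (f : R -> R) s c :
  continuous f s -> c < f s -> locally s (fun y => c < f y).
Proof.
  intros Hf Hc; apply (locally_imp (locally_Rabs f s (f s - c) Hf ltac:(lra))).
  intros y Hy; apply Rabs_lt_between in Hy; lra.
Qed.

(** The curve is a uniform limit of the smooth functions [flat_id d (t y)] as [d] tends to 0. *)
Lemma curves_Ibold_continuous t s :
  curves Ibold t -> continuous (fun y => proj1_sig (t y)) s.
Proof.
  intros Ht; apply continuous_Rabs; intros eps He.
  (* Two approximation errors of at most [4 * d] and an oscillation of [eps / 10] add up to at most
     [9/10 * eps]. *)
  set (d := Rmin (1/8) (eps / 10)).
  assert (Hd : 0 < d <= 1/8 /\ d <= eps / 10).
  { unfold d; pose proof (Rmin_l (1/8) (eps/10)); pose proof (Rmin_r (1/8) (eps/10)).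
    pose proof (Rmin_pos (1/8) (eps/10) ltac:(lra) ltac:(lra)); lra. }
  pose proof (smooth_at_continuous _ _ (curves_Ibold_flat_id t d s Ht (proj1 Hd))) as Hc.
  apply (locally_imp (locally_Rabs _ s (eps / 10) Hc ltac:(lra))).
  intros y Hy.
  pose proof (flat_id_near d _ (proj1 Hd) (proj2_sig (t y))) as H1.
  pose proof (flat_id_near d _ (proj1 Hd) (proj2_sig (t s))) as H2.
  apply Rabs_lt_between in Hy.
  apply Rabs_le_between in H1; apply Rabs_le_between in H2.
  apply Rabs_lt_between; lra.
Qed.

Lemma curves_Ibold_smooth_at t s :
  curves Ibold t -> 0 < proj1_sig (t s) < 1 -> smooth_at (fun y => proj1_sig (t y)) s.
Proof.
  intros Ht H.
  set (m := Rmin (proj1_sig (t s)) (1 - proj1_sig (t s))).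
  assert (Hm : 0 < m <= proj1_sig (t s) /\ m <= 1 - proj1_sig (t s)).
  { unfold m; pose proof (Rmin_l (proj1_sig (t s)) (1 - proj1_sig (t s))).
    pose proof (Rmin_r (proj1_sig (t s)) (1 - proj1_sig (t s))).
    pose proof (Rmin_pos (proj1_sig (t s)) (1 - proj1_sig (t s)) ltac:(lra) ltac:(lra)).
    lra. }
  (* [flat_id (m / 8)] is exact at distance at least [m / 4] from the ends, and [t y] keeps distance
     [3 * m / 4] while it is within [m / 4] of [t s]. *)
  apply (smooth_at_ext_loc (fun y => flat_id (m / 8) (proj1_sig (t y)))).
  - pose proof (curves_Ibold_continuous t s Ht) as Hc.
    apply (locally_imp (locally_Rabs _ s (m / 4) Hc ltac:(lra))).
    intros y Hy; apply Rabs_lt_between in Hy; apply flat_id_mid; lra.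
  - apply curves_Ibold_flat_id; [exact Ht|lra].
Qed.

(** Where [r] meets an end, continuity alone makes a generating function constant along [r] nearby.
    Elsewhere [r] is reparametrized by a localizing map into a curve smooth on all of [R]; this is
    why smoothness is assumed on a neighbourhood. *)
Lemma curves_Ibold_intro (r : R -> I01) :
  (forall s,
    ((proj1_sig (r s) = 0 \/ proj1_sig (r s) = 1) /\
      continuous (fun y => proj1_sig (r y)) s) \/
    locally s (smooth_at (fun y => proj1_sig (r y)))) ->
  curves Ibold r.
Proof.
  intros H g (Hg & e & He & H0 & H1); apply smooth_smooth_at; intros s.
  destruct (H s) as [[[E|E] Hc]|Hs].
  - apply (smooth_at_ext_loc (fun _ => g (r s))); [|apply smooth_at_const].
    apply (locally_imp (locally_lt _ s e Hc ltac:(lra))).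
    intros y Hy; apply H0; lra.
  - apply (smooth_at_ext_loc (fun _ => g (r s))); [|apply smooth_at_const].
    apply (locally_imp (locally_gt _ s (1 - e) Hc ltac:(lra))).
    intros y Hy; apply H1; lra.
  - destruct (localizing_map s _ Hs) as (th & Hth & Hr & Hid).
    apply (smooth_at_ext_loc (fun y => g (r (th y)))).
    + apply (locally_imp Hid); intros y Hy; now rewrite Hy.
    + apply (proj1 (smooth_smooth_at _)).
      apply (Hg (fun y => r (th y))); intros k (k0 & Hk0 & ->).
      apply (Hk0 (fun y => proj1_sig (r (th y)))); intros k1 Hk1.
      apply smooth_smooth_at; intros v; rewrite smooth_smooth_at in Hk1.
      apply (smooth_at_comp k1); [apply Hk1|].
      apply (smooth_at_comp (fun y => proj1_sig (r y))); [apply Hr|apply Hth].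
Qed.

(** * Quotients *)

Lemma qclass_eq {T : Type} (E : T -> T -> Prop) a b : E a b -> qclass E a = qclass E b.
Proof.
  intros H; unfold qclass.
  assert (EQ : clos_refl_sym_trans T E a = clos_refl_sym_trans T E b).
  { apply functional_extensionality; intros c; apply propositional_extensionality.
    split; intros Hc.
    - apply rst_trans with a; [apply rst_sym, rst_step, H|exact Hc].
    - apply rst_trans with b; [apply rst_step, H|exact Hc]. }
  apply eq_sig_hprop; [intros; apply proof_irrelevance|exact EQ].
Qed.

Lemma qclass_inv {T : Type} (E : T -> T -> Prop) a b :
  qclass E a = qclass E b -> clos_refl_sym_trans T E a b.
Proof.
  intros H; apply (f_equal (@proj1_sig _ _)) in H; simpl in H.
  rewrite H; apply rst_refl.
Qed.

Lemma clos_rst_invariant {T B : Type} (E : T -> T -> Prop) (F : T -> B) :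
  (forall a b, E a b -> F a = F b) ->
  forall a b, clos_refl_sym_trans T E a b -> F a = F b.
Proof.
  intros HF a b H; induction H; [auto|reflexivity|auto|congruence].
Qed.

Lemma qclass_surj {T : Type} (E : T -> T -> Prop) (q : Quot T E) :
  exists z, q = qclass E z.
Proof.
  destruct q as [P [z Hz]]; exists z; subst P; reflexivity.
Qed.

(** Representatives are picked by choice; functions invariant under the relation do not see which
    one was picked. *)
Definition qrepr {T : Type} {E : T -> T -> Prop} (q : Quot T E) : T :=
  proj1_sig (constructive_indefinite_description _ (qclass_surj E q)).

Lemma qrepr_invariant {T B : Type} (E : T -> T -> Prop) (F : T -> B) :
  (forall a b, E a b -> F a = F b) -> forall z, F (qrepr (qclass E z)) = F z.
Proof.
  intros HF z; unfold qrepr.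
  destruct (constructive_indefinite_description _ _) as [z' Hz]; simpl.
  symmetry; apply (clos_rst_invariant E F HF), qclass_inv, Hz.
Qed.

(** * The flattened mapping cylinder *)

Lemma smooth_map_of_curves (A B : Frolicher) (phi : A -> B) :
  (forall c, curves A c -> curves B (fun s => phi (c s))) -> smooth_map A B phi.
Proof.
  intros H g Hg; apply funcs_spec; intros c Hc.
  exact (proj1 (curves_spec B _) (H c Hc) g Hg).
Qed.

Lemma curves_prodF (A B : Frolicher) (c : R -> A * B) :
  curves (prodF A B) c <->
  curves A (fun s => fst (c s)) /\ curves B (fun s => snd (c s)).
Proof.
  split.
  - intros Hc; split; apply curves_spec; intros g Hg.
    + apply (Hc (fun p => g (fst p))); left; now exists g.
    + apply (Hc (fun p => g (snd p))); right; now exists g.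
  - intros [HA HB] g [(k & Hk & ->)|(k & Hk & ->)].
    + exact (proj1 (curves_spec A _) HA k Hk).
    + exact (proj1 (curves_spec B _) HB k Hk).
Qed.

Section MappingCylinder.

Variables (X Y : Frolicher) (f : X -> Y).

Definition cyl_pt (t : I01) (x : X) : Icyl X Y f := qclass (cyl_rel X Y f) (inl (t, x)).

Definition cyl_base (y : Y) : Icyl X Y f := qclass (cyl_rel X Y f) (inr y).

Lemma cyl_glue x : cyl_pt Ione x = cyl_base (f x).
Proof. apply qclass_eq; now exists x. Qed.

Lemma cyl_cases (z : Icyl X Y f) :
  (exists t x, z = cyl_pt t x) \/ (exists y, z = cyl_base y).
Proof.
  destruct (qclass_surj _ z) as [[[t x]|y] ->]; [left|right].
  - now exists t, x.
  - now exists y.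
Qed.

(** The map out of the pushout, defined through an arbitrary representative; agreement on glued
    points enters only in the computation rules. *)
Definition cyl_lift {B : Type} (F : I01 -> X -> B) (G : Y -> B) (z : Icyl X Y f) : B :=
  match qrepr z with inl p => F (fst p) (snd p) | inr y => G y end.

Section Lift.

Variables (B : Type) (F : I01 -> X -> B) (G : Y -> B).
Hypothesis FG : forall x, F Ione x = G (f x).

Lemma cyl_lift_invariant a b : cyl_rel X Y f a b ->
  match a with inl p => F (fst p) (snd p) | inr y => G y end =
  match b with inl p => F (fst p) (snd p) | inr y => G y end.
Proof. intros (x & -> & ->); exact (FG x). Qed.

Lemma cyl_lift_pt t x : cyl_lift F G (cyl_pt t x) = F t x.
Proof. exact (qrepr_invariant _ _ cyl_lift_invariant (inl (t, x))). Qed.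

Lemma cyl_lift_base y : cyl_lift F G (cyl_base y) = G y.
Proof. exact (qrepr_invariant _ _ cyl_lift_invariant (inr y)). Qed.

End Lift.

(** The structure is final, so functions are tested only on curves coming from the two pieces, and a
    curve of the product is a pair of curves. *)
Lemma funcs_Icyl_intro (h : Icyl X Y f -> R) :
  (forall t x, curves Ibold t -> curves X x -> smooth (fun s => h (cyl_pt (t s) (x s)))) ->
  (forall y, curves Y y -> smooth (fun s => h (cyl_base (y s)))) ->
  funcs (Icyl X Y f) h.
Proof.
  intros H1 H2 c (d & Hd & ->).
  apply (Hd (fun w => h (qclass (cyl_rel X Y f) w))).
  intros d' [(e & He & ->)|(e & He & ->)].
  - apply curves_prodF in He; destruct He as [Ht Hx].
    pose proof (H1 _ _ Ht Hx) as H; unfold cyl_pt in H.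
    replace (fun s => h (qclass (cyl_rel X Y f) (inl (e s))))
      with (fun s => h (qclass (cyl_rel X Y f) (inl (fst (e s), snd (e s)))));
      [exact H|].
    apply functional_extensionality; intros s; now destruct (e s).
  - exact (H2 e He).
Qed.

Lemma curves_Icyl_pt t x :
  curves Ibold t -> curves X x -> curves (Icyl X Y f) (fun s => cyl_pt (t s) (x s)).
Proof.
  intros Ht Hx h Hh; apply Hh.
  exists (fun s => inl (t s, x s)); split; [|reflexivity].
  intros k Hk; apply Hk; left; exists (fun s => (t s, x s)); split; [|reflexivity].
  now apply curves_prodF.
Qed.

(** * The height function and the lifting of curves *)

Definition height : Icyl X Y f -> I01 := cyl_lift (fun t _ => t) (fun _ => Ione).

Lemma height_pt t x : height (cyl_pt t x) = t.
Proof. now apply cyl_lift_pt. Qed.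

Lemma height_base y : height (cyl_base y) = Ione.
Proof. now apply cyl_lift_base. Qed.

Lemma height_lt1 z : proj1_sig (height z) < 1 -> exists x, z = cyl_pt (height z) x.
Proof.
  destruct (cyl_cases z) as [(t & x & ->)|(y & ->)]; intros H.
  - exists x; now rewrite height_pt.
  - rewrite height_base in H; simpl in H; lra.
Qed.

Lemma height_eq0 z : proj1_sig (height z) = 0 <-> exists x, z = cyl_incl X Y f x.
Proof.
  split.
  - intros H; destruct (height_lt1 z) as [x Hx]; [lra|].
    exists x; rewrite Hx (I01_eq (height z) Izero H); reflexivity.
  - intros [x ->]; change (proj1_sig (height (cyl_pt Izero x)) = 0).
    now rewrite height_pt.
Qed.

Lemma curves_height z : curves (Icyl X Y f) z -> curves Ibold (fun s => height (z s)).
Proof.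
  intros Hz; apply curves_spec; intros g Hg.
  apply (proj1 (curves_spec _ z) Hz (fun w => g (height w))), funcs_Icyl_intro.
  - intros t x Ht _.
    replace (fun s => g (height (cyl_pt (t s) (x s)))) with (fun s => g (t s));
      [exact (Hg t Ht)|].
    apply functional_extensionality; intros s; now rewrite height_pt.
  - intros y _; apply smooth_smooth_at; intros s.
    apply (smooth_at_ext_loc (fun _ => g Ione)); [|apply smooth_at_const].
    apply filter_forall; intros y'; now rewrite height_base.
Qed.

Lemma height_continuous z s :
  curves (Icyl X Y f) z -> continuous (fun y => proj1_sig (height (z y))) s.
Proof.
  intros Hz; exact (curves_Ibold_continuous _ s (curves_height z Hz)).
Qed.

(** Curves of a final structure do not lift by definition. The [X] coordinate is chosen pointwise
    and tested against a structure function [k] of [X], after [k], cut off near the top, has been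
    extended to a structure function of the cylinder. *)
Lemma curves_Icyl_lift (z : R -> Icyl X Y f) (th : R -> R) :
  curves (Icyl X Y f) z -> (forall s, smooth_at th s) ->
  (forall s, proj1_sig (height (z (th s))) < 7/8) ->
  exists x : R -> X, curves X x /\ forall s, z (th s) = cyl_pt (height (z (th s))) (x s).
Proof.
  intros Hz Hth Hlt.
  destruct (functional_choice
    (fun s x => z (th s) = cyl_pt (height (z (th s))) x)) as [x Hx].
  { intros s; apply height_lt1; specialize (Hlt s); lra. }
  exists x; split; [|exact Hx].
  apply curves_spec; intros k Hk.
  (* [chi] is 1 up to 7/8, where the curve lives, and 0 from 15/16 on, so that [chi * k] glues with
     0 on [Y] and [chi] is flat at both ends. *)
  set (chi := fun t : I01 => 1 - smooth_step (7/8) (15/16) (proj1_sig t)).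
  set (kk := cyl_lift (fun t y => chi t * k y) (fun _ => 0)).
  assert (compat : forall y : X, chi Ione * k y = 0).
  { intros y; unfold chi; simpl; rewrite smooth_step_1; lra. }
  assert (Hkk : funcs (Icyl X Y f) kk).
  { apply funcs_Icyl_intro.
    - intros t y Ht Hy; apply smooth_smooth_at; intros s.
      apply (smooth_at_ext_loc (fun v => chi (t v) * k (y v))).
      { apply filter_forall; intros v; unfold kk.
        now rewrite (cyl_lift_pt _ (fun t y => chi t * k y) (fun _ => 0) compat). }
      apply smooth_at_mult.
      + revert s; apply (curves_Ibold_comp
          (fun v => 1 - smooth_step (7/8) (15/16) v) t (1/16)); [|lra| | |exact Ht].
        * intros s; apply smooth_at_minus; [apply smooth_at_const|].
          apply smooth_at_step; lra.
        * intros a b Ha Hb; rewrite !smooth_step_0; lra.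
        * intros a b Ha Hb; rewrite !smooth_step_1; lra.
      + revert s; apply smooth_smooth_at; exact (proj1 (curves_spec X y) Hy k Hk).
    - intros y _; apply smooth_smooth_at; intros s.
      apply (smooth_at_ext_loc (fun _ => 0)); [|apply smooth_at_const].
      apply filter_forall; intros v; unfold kk.
      now rewrite (cyl_lift_base _ (fun t y => chi t * k y) (fun _ => 0) compat). }
  pose proof (proj1 (curves_spec _ z) Hz kk Hkk) as Hs.
  rewrite smooth_smooth_at in Hs.
  apply smooth_smooth_at; intros s.
  apply (smooth_at_ext_loc (fun v => kk (z (th v)))).
  - apply filter_forall; intros v; rewrite (Hx v); unfold kk.
    rewrite (cyl_lift_pt _ (fun t y => chi t * k y) (fun _ => 0) compat).
    unfold chi; rewrite smooth_step_0; [ring|]. specialize (Hlt v); lra.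
  - apply (smooth_at_comp (fun v => kk (z v))); [apply Hs|apply Hth].
Qed.

(** * The deformation towards the bottom of the cylinder *)

Definition ramp (t : I01) : R := smooth_step (1/4) (3/4) (proj1_sig t).

Definition cutoff (t : R) : R := 1 - smooth_step (1/2) (3/4) t.

Lemma cutoff_range t : 0 <= cutoff t <= 1.
Proof.
  pose proof (smooth_step_range (1/2) (3/4) t ltac:(lra)); unfold cutoff; lra.
Qed.

Lemma ramp_range s : 0 <= ramp s <= 1.
Proof. apply smooth_step_range; lra. Qed.

Lemma push_range (s t : I01) :
  0 <= proj1_sig t * (1 - ramp s * cutoff (proj1_sig t)) <= 1.
Proof.
  pose proof (proj2_sig t) as Ht; simpl in Ht.
  pose proof (ramp_range s); pose proof (cutoff_range (proj1_sig t)).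
  assert (0 <= ramp s * cutoff (proj1_sig t) <= 1) by nra.
  nra.
Qed.

(** The height coordinate of the deformation, with [ramp] as alpha and [cutoff] as beta. *)
Definition push (s t : I01) : I01 := exist _ _ (push_range s t).

Lemma push_le s t : proj1_sig (push s t) <= proj1_sig t.
Proof.
  pose proof (proj2_sig t) as Ht; simpl in Ht; simpl.
  pose proof (ramp_range s); pose proof (cutoff_range (proj1_sig t)).
  assert (0 <= ramp s * cutoff (proj1_sig t)) by nra.
  nra.
Qed.

Lemma push_high s t : 3/4 <= proj1_sig t -> push s t = t.
Proof.
  intros Ht; apply I01_eq; simpl; unfold cutoff; rewrite smooth_step_1; lra.
Qed.

Lemma push_time0 t : push Izero t = t.
Proof.
  apply I01_eq; simpl; unfold ramp; simpl.
  rewrite (smooth_step_0 (1/4)); lra.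
Qed.

Lemma push_height0 s : push s Izero = Izero.
Proof. apply I01_eq; simpl; ring. Qed.

Lemma push_time1 t : proj1_sig t <= 1/2 -> push Ione t = Izero.
Proof.
  intros Ht; apply I01_eq; simpl; unfold ramp, cutoff; simpl.
  rewrite (smooth_step_1 (1/4)); [|lra|lra]. rewrite smooth_step_0; lra.
Qed.

Definition cyl_push (p : I01 * Icyl X Y f) : Icyl X Y f :=
  cyl_lift (fun t x => cyl_pt (push (fst p) t) x) cyl_base (snd p).

Lemma cyl_push_compat s x : cyl_pt (push s Ione) x = cyl_base (f x).
Proof. rewrite push_high; [apply cyl_glue|simpl; lra]. Qed.

Lemma cyl_push_pt s t x : cyl_push (s, cyl_pt t x) = cyl_pt (push s t) x.
Proof.
  exact (cyl_lift_pt _ (fun t x => cyl_pt (push s t) x) cyl_base (cyl_push_compat s) t x).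
Qed.

Lemma cyl_push_base s y : cyl_push (s, cyl_base y) = cyl_base y.
Proof.
  exact (cyl_lift_base _ (fun t x => cyl_pt (push s t) x) cyl_base (cyl_push_compat s) y).
Qed.

Lemma cyl_push_high s z : 3/4 <= proj1_sig (height z) -> cyl_push (s, z) = z.
Proof.
  destruct (cyl_cases z) as [(t & x & ->)|(y & ->)].
  - rewrite height_pt cyl_push_pt; intros H; now rewrite push_high.
  - intros _; apply cyl_push_base.
Qed.

(* Where the height vanishes nothing is assumed about [sig], not even continuity. *)
Lemma smooth_cyl_push (sig : R -> I01) (z : R -> Icyl X Y f) (h : Icyl X Y f -> R) :
  curves (Icyl X Y f) z ->
  (forall s, 0 < proj1_sig (height (z s)) -> smooth_at (fun y => ramp (sig y)) s) ->
  funcs (Icyl X Y f) h ->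
  smooth (fun s => h (cyl_push (sig s, z s))).
Proof.
  intros Hz Hsig Hh; apply smooth_smooth_at; intros s0.
  pose proof (height_continuous z s0 Hz) as Hc.
  (* Above 3/4 the deformation is the identity near [s0]; otherwise the height stays below 7/8 near
     [s0] and the localized curve lifts. *)
  destruct (Rlt_dec (3/4) (proj1_sig (height (z s0)))) as [Hhi|Hlo].
  { apply (smooth_at_ext_loc (fun s => h (z s))).
    - apply (locally_imp (locally_gt _ s0 _ Hc Hhi)).
      intros s Hs; rewrite cyl_push_high; [reflexivity|lra].
    - apply (proj1 (smooth_smooth_at _)).
      exact (proj1 (curves_spec _ z) Hz h Hh). }
  destruct (localizing_map s0 _ (locally_lt _ s0 (7/8) Hc ltac:(lra)))
    as (th & Hth & Hlt & Hid); simpl in Hlt.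
  destruct (curves_Icyl_lift z th Hz Hth Hlt) as (x & Hx & Ex).
  set (r := fun s => push (sig (th s)) (height (z (th s)))).
  assert (Hcth : forall s, continuous (fun y => proj1_sig (height (z (th y)))) s).
  { intros s; apply (continuous_comp th (fun y => proj1_sig (height (z y)))).
    - apply smooth_at_continuous, Hth.
    - apply height_continuous, Hz. }
  assert (Hr : curves Ibold r).
  { apply curves_Ibold_intro; intros s.
    destruct (Rlt_dec 0 (proj1_sig (height (z (th s))))) as [Hp|Hn]; [right|left].
    - apply (locally_imp (locally_gt _ s 0 (Hcth s) Hp)).
      intros y Hy; specialize (Hlt y).
      assert (Ht : smooth_at (fun v => proj1_sig (height (z (th v)))) y).
      { apply (smooth_at_comp (fun v => proj1_sig (height (z v)))); [|apply Hth].
        apply (curves_Ibold_smooth_at _ _ (curves_height z Hz)); lra. }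
      apply smooth_at_mult; [exact Ht|].
      apply smooth_at_minus; [apply smooth_at_const|].
      apply smooth_at_mult.
      + apply (smooth_at_comp (fun v => ramp (sig v))); [now apply Hsig|apply Hth].
      + apply (smooth_at_comp cutoff); [|exact Ht].
        apply smooth_at_minus; [apply smooth_at_const|apply smooth_at_step; lra].
    - pose proof (proj2_sig (height (z (th s)))) as H0; simpl in H0.
      assert (E : proj1_sig (height (z (th s))) = 0) by lra.
      assert (Er : proj1_sig (r s) = 0) by (simpl; rewrite E; ring).
      split; [now left|].
      (* Squeeze: [r] lies between 0 and the height, which is continuous and vanishes at [s]. *)
      apply continuous_Rabs; intros eps He.
      apply (locally_imp (locally_lt _ s eps (Hcth s) ltac:(lra))).
      intros y Hy; rewrite Er.
      pose proof (push_le (sig (th y)) (height (z (th y)))).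
      pose proof (push_range (sig (th y)) (height (z (th y)))) as Hp.
      change (0 <= proj1_sig (r y) <= 1) in Hp.
      change (proj1_sig (r y) <= proj1_sig (height (z (th y)))) in H.
      apply Rabs_lt_between; lra. }
  apply (smooth_at_ext_loc (fun s => h (cyl_pt (r s) (x s)))).
  - apply (locally_imp Hid); intros s Hs.
    unfold r; rewrite -cyl_push_pt -(Ex s) Hs; reflexivity.
  - apply (proj1 (smooth_smooth_at _)).
    exact (proj1 (curves_spec _ _) (curves_Icyl_pt r x Hr Hx) h Hh).
Qed.

(** A curve of [Ibold] may fail to be smooth where it meets an end; there [ramp] is locally
    constant. *)
Lemma smooth_at_ramp t s :
  curves Ibold t -> smooth_at (fun y => ramp (t y)) s.
Proof.
  intros Ht; revert s.
  apply (curves_Ibold_comp (smooth_step (1/4) (3/4)) t (1/8)); [|lra| | |exact Ht].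
  - intros s; apply smooth_at_step; lra.
  - intros a b Ha Hb; rewrite !smooth_step_0; lra.
  - intros a b Ha Hb; rewrite !smooth_step_1; lra.
Qed.

Lemma smooth_map_cyl_push : smooth_map (prodF Ibold (Icyl X Y f)) (Icyl X Y f) cyl_push.
Proof.
  apply smooth_map_of_curves; intros c Hc.
  apply curves_prodF in Hc; destruct Hc as [Ht Hz].
  apply curves_spec; intros h Hh.
  pose proof (smooth_cyl_push _ _ h Hz (fun s _ => smooth_at_ramp _ s Ht) Hh) as H.
  replace (fun s => h (cyl_push (c s)))
    with (fun s => h (cyl_push (fst (c s), snd (c s)))); [exact H|].
  apply functional_extensionality; intros s; now destruct (c s).
Qed.

Lemma open_interval a b : open (fun s : R => a < s < b).
Proof. apply open_and; [apply open_gt|apply open_lt]. Qed.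

(** Points of [Lambda] have height 0, so the time parameter is smooth near any point of positive
    height. *)
Lemma FCIP_cyl_push : FCIP_map (cyl_incl X Y f) cyl_push.
Proof.
  intros h Hh t z Hz Ht; apply smooth_cyl_push; [exact Hz| |exact Hh].
  intros s0 Hs0.
  destruct (locally_gt _ s0 0 (height_continuous z s0 Hz) Hs0) as [d Hd].
  pose proof (cond_pos d) as Hp.
  apply (smooth_at_comp (smooth_step (1/4) (3/4)) (fun y => proj1_sig (t y)));
    [apply smooth_at_step; lra|].
  apply (smooth_on_smooth_at (fun s => s0 - d / 2 < s < s0 + d / 2));
    [apply open_interval|lra|].
  (* A point within [d / 2] of some [s] in the interval is within [d] of [s0], where the height is
     positive. *)
  apply (Ht (d / 2)); [lra|].
  intros s Hs s1 [Hin _] Hs1.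
  apply height_eq0 in Hin.
  assert (Hb : Rabs (s1 - s0) < d) by (apply Rabs_lt_between; lra).
  specialize (Hd s1 Hb); lra.
Qed.

(** * The function whose zero set is the bottom *)

Lemma double_range (t : I01) : 0 <= Rmin 1 (2 * proj1_sig t) <= 1.
Proof.
  pose proof (proj2_sig t) as Ht; simpl in Ht; split.
  - apply Rmin_glb; lra.
  - apply Rmin_l.
Qed.

Definition cyl_dist (z : Icyl X Y f) : I01 := exist _ _ (double_range (height z)).

(** The kink of [Rmin] sits at the value 1, where a curve of [Ibold] only has to be continuous. *)
Lemma smooth_map_cyl_dist : smooth_map (Icyl X Y f) Ibold cyl_dist.
Proof.
  apply smooth_map_of_curves; intros z Hz; apply curves_Ibold_intro; intros s.
  pose proof (height_continuous z s Hz) as Hc.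
  assert (Hm : continuous (fun y => Rmin 1 (2 * proj1_sig (height (z y)))) s).
  { apply continuous_Rabs; intros eps He.
    apply (locally_imp (locally_Rabs _ s (eps / 2) Hc ltac:(lra))).
    intros y Hy; apply Rabs_lt_between in Hy; apply Rabs_lt_between.
    unfold Rmin; repeat destruct Rle_dec; lra. }
  pose proof (proj2_sig (height (z s))) as Hr; simpl in Hr.
  destruct (Rlt_dec 0 (proj1_sig (height (z s)))) as [Hp|Hn].
  - destruct (Rlt_dec (proj1_sig (height (z s))) (1/2)) as [Hl|Hl].
    + right.
      assert (HL : locally s (fun y => 0 < proj1_sig (height (z y)) /\
                                       proj1_sig (height (z y)) < 1/2)).
      { apply filter_and; [now apply locally_gt|now apply locally_lt]. }
      apply (locally_imp (locally_locally _ _ HL)).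
      intros y Hy; pose proof (locally_singleton _ _ Hy) as Hy0.
      apply (smooth_at_ext_loc (fun v => 2 * proj1_sig (height (z v)))).
      * apply (locally_imp Hy); intros v Hv; simpl; rewrite Rmin_right; lra.
      * apply smooth_at_mult; [apply smooth_at_const|].
        apply (curves_Ibold_smooth_at _ _ (curves_height z Hz)); lra.
    + left; split; [right; simpl; rewrite Rmin_left; lra|exact Hm].
  - left; split; [left; simpl; rewrite Rmin_right; lra|exact Hm].
Qed.

Lemma cyl_dist_eq0 z : proj1_sig (cyl_dist z) = 0 <-> proj1_sig (height z) = 0.
Proof.
  pose proof (proj2_sig (height z)); simpl; unfold Rmin; destruct Rle_dec; lra.
Qed.

(** * The inclusion of the bottom *)

Lemma smooth_map_cyl_incl : smooth_map X (Icyl X Y f) (cyl_incl X Y f).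
Proof.
  apply smooth_map_of_curves; intros c Hc.
  apply (curves_Icyl_pt (fun _ => Izero)); [|exact Hc].
  intros g _; apply smooth_smooth_at; intros s; apply smooth_at_const.
Qed.

Lemma cyl_incl_inj a b : cyl_incl X Y f a = cyl_incl X Y f b -> a = b.
Proof.
  intros H; apply qclass_inv in H.
  (* Being the point [(Izero, b)] is invariant under the gluing, which relates only points at height
     1 to points of [Y]. *)
  apply (clos_rst_invariant _ (fun w => w = inl (Izero, b))) in H.
  - symmetry in H; assert (E : @inl (I01 * X) Y (Izero, a) = inl (Izero, b))
      by (rewrite -H; reflexivity).
    congruence.
  - intros v w (x & -> & ->); apply propositional_extensionality; split.
    + intros E; injection E as E1 E2.
      lra.
    + discriminate.
Qed.

End MappingCylinder.

(** * Verification of the SNDR conditions *)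

Theorem theorem5 (X Y : Frolicher) (f : X -> Y) :
  smooth_map X Y f -> SNDR_pair (Icyl X Y f) X (cyl_incl X Y f).
Proof.
  intros _; split; [apply smooth_map_cyl_incl|split; [apply cyl_incl_inj|]].
  exists (cyl_dist X Y f), (cyl_push X Y f); split; [apply smooth_map_cyl_dist|].
  split; [intros z; rewrite cyl_dist_eq0; apply height_eq0|].
  split; [apply smooth_map_cyl_push|split; [apply FCIP_cyl_push|]].
  split; [|split].
  - intros z; destruct (cyl_cases X Y f z) as [(t & x & ->)|(y & ->)].
    + rewrite cyl_push_pt push_time0; reflexivity.
    + apply cyl_push_base.
  - intros t a; change (cyl_push X Y f (t, cyl_pt X Y f Izero a) = cyl_pt X Y f Izero a).
    rewrite cyl_push_pt push_height0; reflexivity.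
  - intros z Hz; simpl in Hz.
    (* Below height 1/2 [cutoff] is 1, so the push at time 1 ends at height 0. *)
    assert (Hh : proj1_sig (height X Y f z) < 1/2)
      by (revert Hz; unfold Rmin; destruct Rle_dec; lra).
    destruct (height_lt1 X Y f z) as [x Hx]; [lra|].
    exists x; rewrite Hx cyl_push_pt push_time1; [reflexivity|lra].
Qed.
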